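(* Let $F$ be a finite field. Every idempotent element in $Z(M_2(F))$ is of one of the following forms: (i) $E_0$, $E^0$, $E_a$, $E^a$, $F_a$, $F^a$ for some $a\in F\setminus\{0\}$; (ii) $E_{ij}$ for some $i\in F\setminus\{0,1\}$ and $j\in F\setminus\{0\}$.
   Context: $Z(M_2(F))$ denotes the set of nonzero zero-divisors of the ring $M_2(F)$ of $2\times 2$ matrices over $F$. Notation: $E_0=\begin{bmatrix}0&0\\ 0&1\end{bmatrix}$, $E^0=\begin{bmatrix}1&0\\ 0&0\end{bmatrix}$, $E_a=\begin{bmatrix}0&0\\ a&1\end{bmatrix}$, $E^a=\begin{bmatrix}1&a\\ 0&0\end{bmatrix}$, $F^a=\begin{bmatrix}0&a\\ 0&1\end{bmatrix}$, $F_a=\begin{bmatrix}1&0\\ a&0\end{bmatrix}$, $E_{ij}=\begin{bmatrix}i&j(1-i)\\ \frac{i}{j}&1-i\end{bmatrix}$. *)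

(* Defs.v *)
From mathcomp Require Import all_boot all_order all_algebra.

Set Implicit Arguments.
Unset Strict Implicit.
Unset Printing Implicit Defensive.

Import GRing.Theory.
Local Open Scope ring_scope.

(* In a noncommutative ring, a zero-divisor is an element annihilated by a
   nonzero element on at least one side. *)
Definition zero_divisor (R : pzRingType) (x : R) : Prop :=
  exists2 y : R, y != 0 & x * y = 0 \/ y * x = 0.

Definition nonzero_zero_divisor (R : pzRingType) (x : R) : Prop :=
  x != 0 /\ zero_divisor x.

Definition idempotent_elt (R : pzRingType) (x : R) : Prop := x * x = x.

Definition mx22 (R : nmodType) (a b c d : R) : 'M[R]_2 :=
  \matrix_(i < 2, j < 2) nth 0 (nth [::] [:: [:: a; b]; [:: c; d]] i) j.

Section IdempotentFamilies.

Variable F : fieldType.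
Implicit Types a i j : F.

(* Suffix [_lo] is a subscript in the usual notation, [_up] a superscript:
   [E_lo a] is E_a and [E_up a] is E^a. E_0 and E^0 are [E_lo 0] and
   [E_up 0]. *)
Definition E_lo a : 'M[F]_2 := mx22 0 0
                                    a 1.
Definition E_up a : 'M[F]_2 := mx22 1 a
                                    0 0.
Definition F_lo a : 'M[F]_2 := mx22 1 0
                                    a 0.
Definition F_up a : 'M[F]_2 := mx22 0 a
                                    0 1.
Definition E_ij i j : 'M[F]_2 := mx22 i       (j * (1 - i))
                                      (i / j) (1 - i).

End IdempotentFamilies.

(* Main.v *)
Require Import Defs.
From mathcomp Require Import all_boot all_order all_algebra.
From mathcomp Require Import ring.
Import GRing.Theory.
Local Open Scope ring_scope.

(** An idempotent that is a zero-divisor cannot be the identity, so the matrix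
    [A] at hand is an idempotent other than 0 and 1; such a 2 x 2 matrix has
    rank one, hence trace 1 and determinant 0 ([mx22_idem_nontrivial]).
    Writing its entries as [i, b; c, 1 - i], the only remaining constraint is
    [b * c = i * (1 - i)].  If [i] is 0 or 1 then [b] or [c] vanishes, and the
    other entry is the parameter of one of the families E, F.  Otherwise [b] and
    [c] are both nonzero and determine each other, so that [j = b / (1 - i)]
    parametrizes the remaining idempotents ([mx22_trace1_det0]). *)

Lemma zero_divisor_neq1 {R : pzRingType} {x : R} : zero_divisor x -> x <> 1.
Proof.
by case=> y y0 + x1; rewrite x1 mul1r mulr1; case=> /eqP; apply/negP.
Qed.

Lemma mx22_eta (R : nmodType) (A : 'M[R]_2) :
  A = mx22 (A 0 0) (A 0 1) (A 1 0) (A 1 1).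
Proof.
by apply/matrixP=> -[[|[|//]] ?] [[|[|//]] ?]; rewrite mxE /=;
  congr (A _ _); apply/val_inj.
Qed.

Lemma mx22_inj {R : nmodType} {a b c d a' b' c' d' : R} :
  mx22 a b c d = mx22 a' b' c' d' -> [/\ a = a', b = b', c = c' & d = d'].
Proof.
by move=> /matrixP e; split; [move: (e 0 0) | move: (e 0 1)
  | move: (e 1 0) | move: (e 1 1)]; rewrite !mxE.
Qed.

Lemma mul_mx22 (R : pzRingType) (a b c d a' b' c' d' : R) :
  mx22 a b c d * mx22 a' b' c' d' =
  mx22 (a * a' + b * c') (a * b' + b * d') (c * a' + d * c') (c * b' + d * d').
Proof.
by apply/matrixP=> -[[|[|//]] ?] [[|[|//]] ?];
  rewrite !mxE big_ord_recl big_ord1 !mxE.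
Qed.

Lemma mx22_0 (R : nmodType) : mx22 0 0 0 0 = 0 :> 'M[R]_2.
Proof. by apply/matrixP=> -[[|[|//]] ?] [[|[|//]] ?]; rewrite !mxE. Qed.

Lemma mx22_1 (R : pzRingType) : mx22 1 0 0 1 = 1 :> 'M[R]_2.
Proof. by apply/matrixP=> -[[|[|//]] ?] [[|[|//]] ?]; rewrite !mxE. Qed.

(** The off-diagonal entries of [A * A = A] read [b * (a + d - 1) = 0] and
    [c * (a + d - 1) = 0].  Were the trace not 1, [A] would be diagonal with
    entries in {0, 1} of sum other than 1, so [A] would itself be 0 or 1. *)
Lemma mx22_idem_nontrivial {R : idomainType} {a b c d : R} :
    idempotent_elt (mx22 a b c d) -> mx22 a b c d <> 0 -> mx22 a b c d <> 1 ->
  d = 1 - a /\ b * c = a * (1 - a).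
Proof.
rewrite /idempotent_elt mul_mx22 => /mx22_inj[ea eb ec ed] A0 A1.
have [tr1|trN1] := eqVneq (a + d - 1) 0.
  split; first by apply/eqP; rewrite -subr_eq0 -tr1; apply/eqP; ring.
  by rewrite mulrBr mulr1 -{1}ea; ring.
have b0 : b = 0.
  apply/eqP; rewrite -(mulIr_eq0 _ (mulIf trN1)).
  by rewrite -(subrr b) -{2}eb; apply/eqP; ring.
have c0 : c = 0.
  apply/eqP; rewrite -(mulIr_eq0 _ (mulIf trN1)).
  by rewrite -(subrr c) -{2}ec; apply/eqP; ring.
have idem01 (x : R) : x * x = x -> x = 0 \/ x = 1.
  move=> xx; have /eqP : x * (x - 1) = 0 by rewrite mulrBr mulr1 xx subrr.
  by rewrite mulf_eq0 subr_eq0 => /orP[] /eqP; [left | right].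
move: ea ed A0 A1 trN1; rewrite b0 c0 !mul0r addr0 add0r.
case/idem01=> -> /idem01[] ->; rewrite ?mx22_0 ?mx22_1 //.
- by rewrite add0r subrr eqxx.
- by rewrite addr0 subrr eqxx.
Qed.

Lemma mx22_trace1_det0 {F : fieldType} {i b c : F} :
    b * c = i * (1 - i) ->
  let A := mx22 i b c (1 - i) in
  (A = E_lo 0 \/ A = E_up 0 \/
   exists a : F, a != 0 /\
     (A = E_lo a \/ A = E_up a \/ A = F_lo a \/ A = F_up a)) \/
  (exists i j : F, i != 0 /\ i != 1 /\ j != 0 /\ A = E_ij i j).
Proof.
move=> bc A; rewrite {}/A.
have [i0|iN0] := eqVneq i 0.
  left; move: bc; rewrite i0 subr0 mul0r => /eqP.
  rewrite mulf_eq0; have [-> _|bN0 /= /eqP->] := eqVneq b 0.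
    by have [->|cN0] := eqVneq c 0; [left | right; right; exists c; auto].
  by right; right; exists b; do !split=> //; do 3!right.
have [i1|iN1] := eqVneq i 1.
  left; move: bc; rewrite i1 subrr mulr0 => /eqP.
  rewrite mulf_eq0; have [-> _|bN0 /= /eqP->] := eqVneq b 0.
    have [->|cN0] := eqVneq c 0; first by right; left.
    by right; right; exists c; split=> //; right; right; left.
  by right; right; exists b; split=> //; right; left.
right; have i'N0 : 1 - i != 0 by rewrite subr_eq0 eq_sym.
have bN0 : b != 0.
  have : b * c != 0 by rewrite bc mulf_neq0.
  by rewrite mulf_eq0 negb_or => /andP[].
(* The upper right entry [j * (1 - i)] of [E_ij i j] forces this value of j. *)
exists i, (b / (1 - i)); do !split=> //; first by rewrite mulf_neq0 ?invr_eq0.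
rewrite /E_ij divfK //; congr mx22.
by rewrite invf_div mulrA -bc mulrAC divff // mul1r.
Qed.

Theorem lemma2p1 (F : finFieldType) (A : 'M[F]_2)
    (A_zd : nonzero_zero_divisor A) (A_idem : idempotent_elt A) :
  (A = E_lo 0 \/ A = E_up 0 \/
   exists a : F, a != 0 /\
     (A = E_lo a \/ A = E_up a \/ A = F_lo a \/ A = F_up a)) \/
  (exists i j : F, i != 0 /\ i != 1 /\ j != 0 /\ A = E_ij i j).
Proof.
have [/eqP A0 /zero_divisor_neq1 A1] := A_zd.
move: A0 A1 A_idem; rewrite (mx22_eta _ A) => A0 A1 A_idem.
have [-> bc] := mx22_idem_nontrivial A_idem A0 A1.
exact: mx22_trace1_det0.
Qed.
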